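(* Let $V\xrightarrow{R}\mathfrak{g}$ be an rRB Leibniz algebra and let $(W\xrightarrow{S}\mathfrak{h},l,r)$ be a representation of it. Then $(\mathfrak{h}^*\xrightarrow{-S^*}W^*,l^*,r^* )$ is also a representation of $V\xrightarrow{R}\mathfrak{g}$, where $W^*$ and $\mathfrak{h}^*$ are equipped with the dual representations of the Leibniz algebra $\mathfrak{g}$, and the pairings $l^*:V\otimes W^*\to\mathfrak{h}^*$ and $r^*:W^*\otimes V\to\mathfrak{h}^*$ are given by $$l^*(v,f_W)(h)=-f_W(l(v,h)),\qquad r^*(f_W,v)(h)=f_W(l(v,h)+r(h,v)),\quad\text{for }v\in V,\ f_W\in W^*,\ h\in\mathfrak{h}.$$
   Context: All vector spaces and linear maps are over a field $\mathbf{k}$ of characteristic $0$. Leibniz algebra: a vector space $\mathfrak{g}$ with a linear map $[~,~]_\mathfrak{g}:\mathfrak{g}\otimes\mathfrak{g}\to\mathfrak{g}$ satisfying $[x,[y,z]_\mathfrak{g}]_\mathfrak{g}=[[x,y]_\mathfrak{g},z]_\mathfrak{g}+[y,[x,z]_\mathfrak{g}]_\mathfrak{g}$. A representation of $\mathfrak{g}$ is a vector space $V$ with linear maps $l_V:\mathfrak{g}\otimes V\to V$, $r_V:V\otimes\mathfrak{g}\to V$ such that $l_V(x,l_V(y,v))=l_V([x,y]_\mathfrak{g},v)+l_V(y,l_V(x,v))$; $l_V(x,r_V(v,y))=r_V(l_V(x,v),y)+r_V(v,[x,y]_\mathfrak{g})$; $r_V(v,[x,y]_\mathfrak{g})=r_V(r_V(v,x),y)+l_V(x,r_V(v,y))$.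 The dual representation on $V^*$ is given by $l_{V^*}(x,f_V)(v)=-f_V(l_V(x,v))$ and $r_{V^*}(f_V,x)(v)=f_V(l_V(x,v)+r_V(v,x))$ for $x\in\mathfrak{g}$, $f_V\in V^*$, $v\in V$. An rRB Leibniz algebra $V\xrightarrow{R}\mathfrak{g}$ consists of a Leibniz algebra $\mathfrak{g}$, a representation $(V,l_V,r_V)$ of it, and a relative Rota-Baxter operator, i.e. a linear map $R:V\to\mathfrak{g}$ with $[R(v),R(v')]_\mathfrak{g}=R(l_V(R(v),v')+r_V(v,R(v')))$ for $v,v'\in V$. A representation of $V\xrightarrow{R}\mathfrak{g}$ is a triple $(W\xrightarrow{S}\mathfrak{h},l,r)$ where $W$ and $\mathfrak{h}$ are representations of the Leibniz algebra $\mathfrak{g}$ (actions $l_W,r_W$ and $l_\mathfrak{h},r_\mathfrak{h}$), $S:W\to\mathfrak{h}$ is a linear map (a 2-term chain complex), and $l:V\otimes\mathfrak{h}\to W$, $r:\mathfrak{h}\otimes V\to W$ are linear maps such that for all $x\in\mathfrak{g}$, $v\in V$, $h\in\mathfrak{h}$, $w\in W$: $l_W(x,l(v,h))=l(l_V(x,v),h)+l(v,l_\mathfrak{h}(x,h))$; $l(v,l_\mathfrak{h}(x,h))=l(r_V(v,x),h)+l_W(x,l(v,h))$; $l(v,r_\mathfrak{h}(h,x))=r_W(l(v,h),x)+r(h,r_V(v,x))$; $l_W(x,r(h,v))=r(l_\mathfrak{h}(x,h),v)+r(h,l_V(x,v))$; $r(h,l_V(x,v))=r(r_\mathfrak{h}(h,x),v)+l_W(x,r(h,v))$;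 $r(h,r_V(v,x))=r_W(r(h,v),x)+l(v,r_\mathfrak{h}(h,x))$; $l_\mathfrak{h}(R(v),S(w))=S(l_W(R(v),w)+l(v,S(w)))$; $r_\mathfrak{h}(S(w),R(v))=S(r(S(w),v)+r_W(w,R(v)))$. $S^*:\mathfrak{h}^*\to W^*$ is the transpose of $S$. *)

(* Defs.v *)
From HB Require Import structures.
From mathcomp Require Import all_boot all_algebra.
From mathcomp Require Import boolp.

Set Implicit Arguments.
Unset Strict Implicit.
Unset Printing Implicit Defensive.

Import GRing.Theory.
Local Open Scope ring_scope.

(** Vector spaces have arbitrary dimension.  A linear map out of a tensor
    product [U (x) V] is given as a bilinear map on [U] and [V]. *)

(** The algebraic dual [V^*]: all linear forms on [V], with the pointwise
    operations.  [boolp] supplies its equality and choice structures, since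
    [V] need not be finite-dimensional. *)
Definition dual (k : fieldType) (V : lmodType k) : Type := {scalar V}.

Section DualSpace.
Variables (k : fieldType) (V : lmodType k).

HB.instance Definition _ := gen_eqMixin (dual V).
HB.instance Definition _ := gen_choiceMixin (dual V).

Definition mk_dual (f : V -> k) (fP : scalar f) : dual V :=
  HB.pack f (GRing.isLinear.Build k V k *%R f fP).

Lemma dual_ext (f g : dual V) : f =1 g -> f = g.
Proof.
case: f => f [[fA] [fS]]; case: g => g [[gA] [gS]] /= fg.
have {}fg : f = g by apply/funext.
by subst g; congr GRing.Linear.Pack; congr GRing.Linear.Class;
   congr (_ _); apply: Prop_irrelevance.
Qed.

Lemma dual_zero_scalar : scalar (fun _ : V => 0 : k).
Proof. by move=> a u v; rewrite mulr0 addr0. Qed.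

Lemma dual_add_scalar (f g : dual V) : scalar (fun v => f v + g v).
Proof. by move=> a u v; rewrite !linearP /= mulrDr addrACA. Qed.

Lemma dual_opp_scalar (f : dual V) : scalar (fun v => - f v).
Proof. by move=> a u v; rewrite linearP /= opprD mulrN. Qed.

Lemma dual_scale_scalar (c : k) (f : dual V) : scalar (fun v => c * f v).
Proof. by move=> a u v; rewrite linearP /= mulrDr mulrCA. Qed.

Definition dual_zero : dual V := mk_dual dual_zero_scalar.
Definition dual_add (f g : dual V) : dual V := mk_dual (dual_add_scalar f g).
Definition dual_opp (f : dual V) : dual V := mk_dual (dual_opp_scalar f).
Definition dual_scale (c : k) (f : dual V) : dual V :=
  mk_dual (dual_scale_scalar c f).

Lemma dual_addA : associative dual_add.
Proof. by move=> f g h; apply: dual_ext => v; apply: addrA. Qed.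
Lemma dual_addC : commutative dual_add.
Proof. by move=> f g; apply: dual_ext => v; apply: addrC. Qed.
Lemma dual_add0 : left_id dual_zero dual_add.
Proof. by move=> f; apply: dual_ext => v; apply: add0r. Qed.
Lemma dual_addN : left_inverse dual_zero dual_opp dual_add.
Proof. by move=> f; apply: dual_ext => v; apply: addNr. Qed.

HB.instance Definition _ :=
  GRing.isZmodule.Build (dual V) dual_addA dual_addC dual_add0 dual_addN.

Lemma dual_scaleA (a b : k) (f : dual V) :
  dual_scale a (dual_scale b f) = dual_scale (a * b) f.
Proof. by apply: dual_ext => v; apply: mulrA. Qed.
Lemma dual_scale1 : left_id 1 dual_scale.
Proof. by move=> f; apply: dual_ext => v; apply: mul1r. Qed.
Lemma dual_scaleDr : right_distributive dual_scale +%R.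
Proof. by move=> a f g; apply: dual_ext => v; apply: mulrDr. Qed.
Lemma dual_scaleDl (f : dual V) :
  {morph dual_scale^~ f : a b / a + b >-> a + b}.
Proof. by move=> a b; apply: dual_ext => v; apply: mulrDl. Qed.

HB.instance Definition _ := GRing.Zmodule_isLmodule.Build k (dual V)
  dual_scaleA dual_scale1 dual_scaleDr dual_scaleDl.

Lemma dualDE (f g : dual V) (v : V) : (f + g) v = f v + g v.
Proof. by []. Qed.
Lemma dualNE (f : dual V) (v : V) : (- f) v = - f v.
Proof. by []. Qed.
Lemma dualZE (a : k) (f : dual V) (v : V) : (a *: f) v = a * f v.
Proof. by []. Qed.

End DualSpace.

Section Transpose.
Variables (k : fieldType) (W H : lmodType k) (S : {linear W -> H}).

Lemma transpose_scalar (f : dual H) : scalar (fun w => f (S w)).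
Proof. by move=> a u v; rewrite !linearP. Qed.

Definition transpose_fun (f : dual H) : dual W := mk_dual (transpose_scalar f).

Lemma transpose_linear : linear transpose_fun.
Proof. by move=> a f g; apply: dual_ext. Qed.

HB.instance Definition _ :=
  GRing.isLinear.Build k (dual H) (dual W) *:%R transpose_fun transpose_linear.

Definition transpose : {linear dual H -> dual W} := transpose_fun.

End Transpose.

(** Dual actions of a pair [l : U (x) A -> B], [r : A (x) U -> B]:
    [l^*(u, f)(a) = - f (l(u, a))] and [r^*(f, u)(a) = f (l(u, a) + r(a, u))].
    For [A = B] these are the actions of the dual representation; for
    [A = h], [B = W] and [U = V] they are the pairings [l^*] and [r^*]. *)
Section DualActions.
Variables (k : fieldType) (U A B : lmodType k).
Variables (l : {bilinear U -> A -> B}) (r : {bilinear A -> U -> B}).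

Lemma dual_l_scalar (u : U) (f : dual B) : scalar (fun a => - f (l u a)).
Proof. by move=> c a b; rewrite !linearP /= opprD mulrN. Qed.

Lemma dual_r_scalar (f : dual B) (u : U) :
  scalar (fun a => f (l u a + r a u)).
Proof.
move=> c a b; rewrite linearPr linearPl /= addrACA -scalerDr.
by rewrite linearP.
Qed.

Definition dual_l_fun (u : U) (f : dual B) : dual A :=
  mk_dual (dual_l_scalar u f).
Definition dual_r_fun (f : dual B) (u : U) : dual A :=
  mk_dual (dual_r_scalar f u).

Lemma dual_l_bilinear : bilinear_for *:%R *:%R dual_l_fun.
Proof.
split=> [f c u v | u c f g]; apply: dual_ext => a.
  rewrite dualDE dualZE /= linearPl linearP /=.
  by rewrite opprD mulrN.
by rewrite dualDE dualZE /= opprD mulrN.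
Qed.

Lemma dual_r_bilinear : bilinear_for *:%R *:%R dual_r_fun.
Proof.
split=> [u c f g | f c u v]; apply: dual_ext => a //.
rewrite dualDE dualZE /= linearPl linearPr /=.
by rewrite addrACA -scalerDr linearP.
Qed.

HB.instance Definition _ := bilinear_isBilinear.Build k U (dual B) (dual A)
  *:%R *:%R dual_l_fun dual_l_bilinear.
HB.instance Definition _ := bilinear_isBilinear.Build k (dual B) U (dual A)
  *:%R *:%R dual_r_fun dual_r_bilinear.

Definition dual_l : {bilinear U -> dual B -> dual A} := dual_l_fun.
Definition dual_r : {bilinear dual B -> U -> dual A} := dual_r_fun.

End DualActions.

Definition is_leibniz (k : fieldType) (g : lmodType k)
    (br : {bilinear g -> g -> g}) : Prop :=
  forall x y z, br x (br y z) = br (br x y) z + br y (br x z).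

Record is_representation (k : fieldType) (g : lmodType k)
    (br : {bilinear g -> g -> g}) (V : lmodType k)
    (lV : {bilinear g -> V -> V}) (rV : {bilinear V -> g -> V}) : Prop := {
  rep_ll : forall x y v, lV x (lV y v) = lV (br x y) v + lV y (lV x v);
  rep_lr : forall x v y, lV x (rV v y) = rV (lV x v) y + rV v (br x y);
  rep_rr : forall v x y, rV v (br x y) = rV (rV v x) y + lV x (rV v y)
}.

Record is_rRB_leibniz (k : fieldType) (g V : lmodType k)
    (br : {bilinear g -> g -> g})
    (lV : {bilinear g -> V -> V}) (rV : {bilinear V -> g -> V})
    (R : {linear V -> g}) : Prop := {
  rRB_leibniz : is_leibniz br;
  rRB_rep : is_representation br lV rV;
  rRB_op : forall v v', br (R v) (R v') = R (lV (R v) v' + rV v (R v'))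
}.

(** [(W --S--> h, l, r)] is a representation of [V --R--> g]. *)
Record is_rRB_representation (k : fieldType) (g V : lmodType k)
    (br : {bilinear g -> g -> g})
    (lV : {bilinear g -> V -> V}) (rV : {bilinear V -> g -> V})
    (R : {linear V -> g})
    (W h : lmodType k)
    (lW : {bilinear g -> W -> W}) (rW : {bilinear W -> g -> W})
    (lh : {bilinear g -> h -> h}) (rh : {bilinear h -> g -> h})
    (S : {linear W -> h})
    (l : {bilinear V -> h -> W}) (r : {bilinear h -> V -> W}) : Prop := {
  rRB_repW : is_representation br lW rW;
  rRB_reph : is_representation br lh rh;
  rRB_gVh_ll : forall x v a, lW x (l v a) = l (lV x v) a + l v (lh x a);
  rRB_Vgh_ll : forall v x a, l v (lh x a) = l (rV v x) a + lW x (l v a);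
  rRB_Vhg_lr : forall v a x, l v (rh a x) = rW (l v a) x + r a (rV v x);
  rRB_ghV_lr : forall x a v, lW x (r a v) = r (lh x a) v + r a (lV x v);
  rRB_hgV_rr : forall a x v, r a (lV x v) = r (rh a x) v + lW x (r a v);
  rRB_hVg_rr : forall a v x, r a (rV v x) = rW (r a v) x + l v (rh a x);
  rRB_RS_l : forall v w, lh (R v) (S w) = S (lW (R v) w + l v (S w));
  rRB_RS_r : forall w v, rh (S w) (R v) = S (r (S w) v + rW w (R v))
}.

(* Main.v *)
(** Every axiom is tested on an element of the predual, where it becomes the
    image under a linear form of a combination of the original axioms.  The
    only combinations which are not axioms themselves are the cancellations
    [(v.x).y + (x.v).y = 0] and their mixed analogues, obtained by comparing
    the two axioms that expand the same term. *)

Require Import Defs.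
From mathcomp Require Import all_boot all_algebra ring.

Import GRing.Theory.
Local Open Scope ring_scope.

(** Substituting [rep_lr] into [rep_rr] makes [rV v (br x y)] cancel. *)
Lemma rep_rl_rr {k : fieldType} {g : lmodType k}
    {br : {bilinear g -> g -> g}} {V : lmodType k}
    {lV : {bilinear g -> V -> V}} {rV : {bilinear V -> g -> V}}
    (HV : is_representation br lV rV) (v : V) (x y : g) :
  rV (rV v x) y = - rV (lV x v) y.
Proof.
apply: (addIr (lV x (rV v y))).
by rewrite -(rep_rr HV) (rep_lr HV) addKr.
Qed.

(** Serves for both [h] and [W], which swap places in the dual. *)
Lemma dual_representation {k : fieldType} {g : lmodType k}
    {br : {bilinear g -> g -> g}} {V : lmodType k}
    {lV : {bilinear g -> V -> V}} {rV : {bilinear V -> g -> V}}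
    (HV : is_representation br lV rV) :
  is_representation br (dual_l lV) (dual_r lV rV).
Proof.
split=> [x y f | x f y | f x y]; apply: dual_ext => v /=;
  rewrite ?linearD /=.
- by rewrite (rep_ll HV x y) linearD; ring.
- by rewrite (rep_ll HV x y) (rep_lr HV x v y) !linearD /=; ring.
- rewrite linearDl !linearD /= (rep_ll HV x y) (rep_lr HV x v y).
  (* The iterated right action leaves [rV (lV y v + rV v y) x], which vanishes. *)
  by rewrite (rep_rl_rr HV) !linearD linearN /=; ring.
Qed.

Section Cancellations.
Context {k : fieldType} {g V : lmodType k} {br : {bilinear g -> g -> g}}.
Context {lV : {bilinear g -> V -> V}} {rV : {bilinear V -> g -> V}}.
Context {R : {linear V -> g}} {W h : lmodType k}.
Context {lW : {bilinear g -> W -> W}} {rW : {bilinear W -> g -> W}}.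
Context {lh : {bilinear g -> h -> h}} {rh : {bilinear h -> g -> h}}.
Context {S : {linear W -> h}}.
Context {l : {bilinear V -> h -> W}} {r : {bilinear h -> V -> W}}.
Context (HS : is_rRB_representation br lV rV R lW rW lh rh S l r).

(** [rRB_hVg_rr] and [rRB_Vhg_lr] share [r a (rV v x)] and [l v (rh a x)], which cancel. *)
Lemma rRB_rW_rl (a : h) (v : V) (x : g) : rW (r a v) x = - rW (l v a) x.
Proof.
apply: (addIr (l v (rh a x))).
by rewrite -(rRB_hVg_rr HS) (rRB_Vhg_lr HS) addKr.
Qed.

Lemma rRB_r_rhlh (a : h) (v : V) (x : g) : r (rh a x) v = - r (lh x a) v.
Proof.
apply: (addIr (lW x (r a v))).
by rewrite -(rRB_hgV_rr HS) (rRB_ghV_lr HS) addKr.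
Qed.

End Cancellations.

Theorem proposition4p6 (k : fieldType) (k_char0 : [pchar k] =i pred0)
    (g V : lmodType k)
    (br : {bilinear g -> g -> g})
    (lV : {bilinear g -> V -> V}) (rV : {bilinear V -> g -> V})
    (R : {linear V -> g})
    (HR : is_rRB_leibniz br lV rV R)
    (W h : lmodType k)
    (lW : {bilinear g -> W -> W}) (rW : {bilinear W -> g -> W})
    (lh : {bilinear g -> h -> h}) (rh : {bilinear h -> g -> h})
    (S : {linear W -> h})
    (l : {bilinear V -> h -> W}) (r : {bilinear h -> V -> W})
    (HS : is_rRB_representation br lV rV R lW rW lh rh S l r) :
  is_rRB_representation br lV rV R
    (dual_l lh) (dual_r lh rh) (dual_l lW) (dual_r lW rW)
    (\- transpose S) (dual_l l) (dual_r l r).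
Proof.
split; [exact: dual_representation (rRB_reph HS)
       | exact: dual_representation (rRB_repW HS) |..].
- move=> x v f; apply: dual_ext => a /=.
  by rewrite (rRB_gVh_ll HS) linearD; ring.
- move=> v x f; apply: dual_ext => a /=.
  by rewrite (rRB_Vgh_ll HS) linearD; ring.
- move=> v f x; apply: dual_ext => a /=.
  by rewrite !linearD /= (rRB_Vgh_ll HS) (rRB_Vhg_lr HS) !linearD /=; ring.
- move=> x f v; apply: dual_ext => a /=.
  by rewrite !linearD /= (rRB_gVh_ll HS) (rRB_ghV_lr HS) !linearD /=; ring.
- move=> f x v; apply: dual_ext => a /=.
  rewrite linearDl !linearD /= (rRB_gVh_ll HS) (rRB_ghV_lr HS).
  (* Here the vanishing term is [rW (l v a + r a v) x]. *)
  by rewrite (rRB_rW_rl HS) !linearD linearN /=; ring.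
- move=> f v x; apply: dual_ext => a /=.
  rewrite linearDl !linearD /= (rRB_Vgh_ll HS) (rRB_Vhg_lr HS).
  (* Here it is [r (lh x a + rh a x) v]. *)
  by rewrite (rRB_r_rhlh HS) !linearD linearN /=; ring.
(* The term in [l] contains the transpose twice, the others once: the sign in [\- transpose S] thus
   moves that term across the original identity. *)
- move=> v f; apply: dual_ext => w /=.
  by rewrite (rRB_RS_l HS) !linearD /=; ring.
- move=> f v; apply: dual_ext => w /=.
  (* Each [dual_r] adds a left and a right action, so the sum of both compatibilities with [S] is
     needed. *)
  rewrite (rRB_RS_l HS) (rRB_RS_r HS).
  by rewrite !linearD /=; ring.
Qed.
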